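(* The derivability problem for $!\mathbf{L}^*$ (given a sequent $\Pi \to A$ of $!\mathbf{L}^*$, decide whether it is derivable in $!\mathbf{L}^*$) is algorithmically undecidable. Moreover, the derivability problem is undecidable even for the fragment $!\mathbf{L}^*_{/}$ (given a sequent $\Pi\to A$ of $!\mathbf{L}^*_{/}$, decide whether it is derivable in $!\mathbf{L}^*_{/}$).
   Context: Fix a countably infinite set $\mathrm{Var}=\{p,q,r,\ldots\}$ of variables (primitive types). Formulae of $!\mathbf{L}^*$ are built from variables using the binary connectives $/$ and $\backslash$ and the unary connective $!$. Sequents are expressions $\Pi \to A$, where $A$ is a formula and $\Pi$ is a finite, possibly empty, linearly ordered sequence of formulae. Below $A,B,C$ (possibly with indices) range over formulae and capital Greek letters over finite, possibly empty, sequences of formulae. The calculus $!\mathbf{L}^*$ has the axioms $A \to A$ and the following rules (there is no cut rule and no weakening rule): - $(/\to)$: from $\Gamma \to A$ and $\Delta_1, B, \Delta_2 \to C$ infer $\Delta_1, B/A, \Gamma, \Delta_2 \to C$. - $(\to/)$: from $\Gamma, A \to B$ infer $\Gamma \to B/A$. - $(\backslash\to)$: from $\Gamma \to A$ and $\Delta_1, B, \Delta_2 \to C$ infer $\Delta_1, \Gamma, A\backslash B, \Delta_2 \to C$. - $(\to\backslash)$: from $A, \Gamma \to B$ infer $\Gamma \to A\backslash B$. - $(!\to)$: from $\Gamma_1, A, \Gamma_2 \to C$ infer $\Gamma_1, !A, \Gamma_2 \to C$. - $(\to !)$: from $!A_1,\ldots,!A_n \to B$ infer $!A_1,\ldots,!A_n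 \to {!}B$. - $(\mathrm{perm}_1)$: from $\Delta_1, !A, \Gamma, \Delta_2 \to C$ infer $\Delta_1, \Gamma, !A, \Delta_2 \to C$. - $(\mathrm{perm}_2)$: from $\Delta_1, \Gamma, !A, \Delta_2 \to C$ infer $\Delta_1, !A, \Gamma, \Delta_2 \to C$. - $(\mathrm{contr})$: from $\Delta_1, !A, !A, \Delta_2 \to C$ infer $\Delta_1, !A, \Delta_2 \to C$. The fragment $!\mathbf{L}^*_{/}$ is obtained by restricting to formulae built from variables using only $/$ and $!$ (dropping the rules for $\backslash$). *)

(* Defs.v *)
From mathcomp Require Import all_boot.

Set Implicit Arguments.
Unset Strict Implicit.
Unset Printing Implicit Defensive.

(* [Over B A] is B / A and [Under A B] is A \ B: arguments come in the
   order in which they are written. *)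
Inductive formula : Type :=
| Var of nat
| Over of formula & formula
| Under of formula & formula
| Bang of formula.

Definition sequent : Type := seq formula * formula.

Inductive derivable : seq formula -> formula -> Prop :=
| d_ax A : derivable [:: A] A
| d_over_l G D1 D2 A B C :
    derivable G A -> derivable (D1 ++ B :: D2) C ->
    derivable (D1 ++ Over B A :: G ++ D2) C
| d_over_r G A B : derivable (rcons G A) B -> derivable G (Over B A)
| d_under_l G D1 D2 A B C :
    derivable G A -> derivable (D1 ++ B :: D2) C ->
    derivable (D1 ++ G ++ Under A B :: D2) C
| d_under_r G A B : derivable (A :: G) B -> derivable G (Under A B)
| d_bang_l G1 G2 A C :
    derivable (G1 ++ A :: G2) C -> derivable (G1 ++ Bang A :: G2) C
| d_bang_r G B :
    derivable (map Bang G) B -> derivable (map Bang G) (Bang B)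
| d_perm1 D1 G D2 A C :
    derivable (D1 ++ Bang A :: G ++ D2) C ->
    derivable (D1 ++ G ++ Bang A :: D2) C
| d_perm2 D1 G D2 A C :
    derivable (D1 ++ G ++ Bang A :: D2) C ->
    derivable (D1 ++ Bang A :: G ++ D2) C
| d_contr D1 D2 A C :
    derivable (D1 ++ Bang A :: Bang A :: D2) C ->
    derivable (D1 ++ Bang A :: D2) C.

Fixpoint over_formula (A : formula) : bool :=
  match A with
  | Var _ => true
  | Over B A => over_formula B && over_formula A
  | Under _ _ => false
  | Bang A => over_formula A
  end.

Definition over_sequent (S : sequent) : bool :=
  all over_formula S.1 && over_formula S.2.

(* Restricting the axiom suffices to keep every derivable sequent inside the
   fragment, since each remaining rule preserves it; see
   [derivable_over_fragment]. *)
Inductive derivable_over : seq formula -> formula -> Prop :=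
| o_ax A : over_formula A -> derivable_over [:: A] A
| o_over_l G D1 D2 A B C :
    derivable_over G A -> derivable_over (D1 ++ B :: D2) C ->
    derivable_over (D1 ++ Over B A :: G ++ D2) C
| o_over_r G A B :
    derivable_over (rcons G A) B -> derivable_over G (Over B A)
| o_bang_l G1 G2 A C :
    derivable_over (G1 ++ A :: G2) C -> derivable_over (G1 ++ Bang A :: G2) C
| o_bang_r G B :
    derivable_over (map Bang G) B -> derivable_over (map Bang G) (Bang B)
| o_perm1 D1 G D2 A C :
    derivable_over (D1 ++ Bang A :: G ++ D2) C ->
    derivable_over (D1 ++ G ++ Bang A :: D2) C
| o_perm2 D1 G D2 A C :
    derivable_over (D1 ++ G ++ Bang A :: D2) C ->
    derivable_over (D1 ++ Bang A :: G ++ D2) C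
| o_contr D1 D2 A C :
    derivable_over (D1 ++ Bang A :: Bang A :: D2) C ->
    derivable_over (D1 ++ Bang A :: D2) C.

Lemma derivable_over_fragment G C :
  derivable_over G C -> over_sequent (G, C).
Proof.
rewrite /over_sequent.
elim=> {G C} [A|G D1 D2 A B C _ IH1 _ IH2|G A B _ IH|G1 G2 A C _ IH|G B _ IH
  |D1 G D2 A C _ IH|D1 G D2 A C _ IH|D1 D2 A C _ IH] /=.
- by move=> ->.
- move: IH1 IH2; rewrite !all_cat /= all_cat.
  by case/andP=> -> -> /andP[/and3P[-> -> ->] ->].
- by move: IH; rewrite all_rcons => /andP[/andP[-> ->] ->].
- by move: IH; rewrite !all_cat.
- by move: IH.
- by move: IH; rewrite !all_cat /= !all_cat /= => /andP[/and4P[-> -> -> ->] ->].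
- by move: IH; rewrite !all_cat /= !all_cat /= => /andP[/and4P[-> -> -> ->] ->].
- by move: IH; rewrite !all_cat /= => /andP[/and4P[-> -> _ ->] ->].
Qed.

(* Algorithms are unlimited register machines (Shepherdson-Sturgis, Minsky):
   countably many registers holding natural numbers, of which a program uses
   finitely many.  [Inc r] adds 1 to register r.  [Dec r j] subtracts 1 from
   register r and proceeds to the next instruction if r is nonzero, and jumps
   to instruction j otherwise.  The machine halts when the program counter
   leaves the program. *)
Inductive instr : Type := Inc of nat | Dec of nat & nat.

Definition program : Type := seq instr.

Record config := Config { pc : nat; reg : nat -> nat }.

Definition set_reg (R : nat -> nat) (r v : nat) : nat -> nat :=
  fun i => if i == r then v else R i.

(* A halted configuration is a fixed point of [step]. *)
Definition step (P : program) (c : config) : config :=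
  let: Config i R := c in
  match onth P i with
  | Some (Inc r) => Config i.+1 (set_reg R r (R r).+1)
  | Some (Dec r j) =>
      if R r is m.+1 then Config i.+1 (set_reg R r m) else Config j R
  | None => c
  end.

Definition halted (P : program) (c : config) : bool := size P <= pc c.

Definition initial (n : nat) : config := Config 0 (set_reg (fun=> 0) 0 n).

Definition computes (P : program) (n m : nat) : Prop :=
  exists k : nat,
    halted P (iter k (step P) (initial n)) /\
    reg (iter k (step P) (initial n)) 0 = m.

(* Goedel numbering; [CodeSeq.code] is the computable bijection
   [:: n1; ...; nk] |-> 2^n1 * (2 * (2^n2 * (2 * ... + 1)) + 1) from seq nat
   to nat. *)
Fixpoint code_formula (A : formula) : nat :=
  match A with
  | Var n => CodeSeq.code [:: 0; n]
  | Over B A => CodeSeq.code [:: 1; code_formula B; code_formula A]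
  | Under A B => CodeSeq.code [:: 2; code_formula A; code_formula B]
  | Bang A => CodeSeq.code [:: 3; code_formula A]
  end.

Definition code_sequent (S : sequent) : nat :=
  CodeSeq.code (code_formula S.2 :: map code_formula S.1).

Lemma code_formula_inj : injective code_formula.
Proof.
have cinj := can_inj CodeSeq.codeK.
elim=> [n|B IHB A IHA|A IHA B IHB|A IHA] [m|B' A'|A' B'|A'] /cinj //.
- by case=> ->.
- by case=> /IHB-> /IHA->.
- by case=> /IHA-> /IHB->.
- by case=> /IHA->.
Qed.

Lemma code_sequent_inj : injective code_sequent.
Proof.
move=> [G A] [G' A'] /(can_inj CodeSeq.codeK)[/code_formula_inj-> e].
by rewrite (inj_map code_formula_inj e).
Qed.

(* Instances are the sequents satisfying [I]; nothing is required of the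
   program on other inputs. *)
Definition decidable_on (I : pred sequent)
    (D : seq formula -> formula -> Prop) : Prop :=
  exists P : program, forall (Pi : seq formula) (A : formula), I (Pi, A) ->
    (D Pi A -> computes P (code_sequent (Pi, A)) 1) /\
    (~ D Pi A -> computes P (code_sequent (Pi, A)) 0).

(* Main.v *)
From HB Require Import structures.
Require Import Defs.
From mathcomp Require Import all_boot.

Set Implicit Arguments.
Unset Strict Implicit.
Unset Printing Implicit Defensive.

(** Undecidability by diagonalization, with register machines encoded in the
    fragment with / and ! only.

    The encoding passes through queue systems: finite lists of rules
    [(u, q, v)] which rewrite a word u X q into X v, consuming u at the front
    of the word and the state q at its end.  Reading s for [Var 0], such a rule
    is the formula ((s / q) / (s / v)) / u: standing in front of u X q, it
    consumes u, asks for a proof that X v yields s, and then turns q into s.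
    A word is accepted when it can be rewritten to a single halting letter.
    As there is no weakening, a derivation must use up the banged copy of
    every rule; so the formula that recognizes the halting letter also takes
    all of them as arguments.

    Acceptance implies derivability by an explicit derivation in the fragment
    ([accepts_derivable]).  The converse ([derivable_accepts]) needs no cut
    elimination: the whole calculus is sound when a formula denotes a set of
    words, / and \ are the residuals of concatenation, and [Bang A] denotes
    the intersection of A with the set containing only the empty word.  Let s
    denote the set of accepted words and every other variable in use the
    corresponding one-letter word; then the empty word belongs to every rule
    formula, and a derivable sequent states that its word is accepted.

    A queue system simulates a register machine by keeping the registers as a
    multiset of tokens followed by a control state; a decrement rotates the
    queue up to a mark while looking for a token ([accepts_halts],
    [halts_accepts]).

    Suppose now that a program P decides derivability.  Putting the input of
    the simulated machine Q at the front of the antecedent, as e copies of a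
    letter x, makes the code of the sequent easy to compute: it is obtained
    from the code e0 of the fixed remaining part by e steps
    m |-> 2 ^ k * (2 m + 1) and a last step of the same shape.  Let Q, on input
    e, start this iteration at e itself, run P on the result, and halt exactly
    when the answer is 0 ([diagonal]).  For e = e0 the number computed is the
    code of the sequent saying that Q halts on e0, and P cannot be right about
    it ([undecidable_between]). *)

(** * Derived rules of the fragment *)

Lemma derivable_over_derivable G C : derivable_over G C -> derivable G C.
Proof.
elim=> {G C}.
- by move=> *; apply: d_ax.
- by move=> *; apply: d_over_l.
- by move=> *; apply: d_over_r.
- by move=> *; apply: d_bang_l.
- by move=> *; apply: d_bang_r.
- by move=> *; apply: d_perm1.
- by move=> *; apply: d_perm2.
- by move=> *; apply: d_contr.
Qed.

(** [overs B [:: A1; ...; An]] is ((B / An) / ...) / A1, so that it consumes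
    A1, ..., An from left to right. *)
Definition overs (B : formula) (As : seq formula) : formula :=
  foldr (fun A X => Over X A) B As.

Lemma overs_in_fragment B As :
  over_formula (overs B As) = over_formula B && all over_formula As.
Proof. by elim: As => [|A As IH] /=; rewrite ?andbT // IH andbAC andbA. Qed.

Lemma over_overs_l As D1 D2 B C :
  all over_formula As -> derivable_over (D1 ++ B :: D2) C ->
  derivable_over (D1 ++ overs B As :: As ++ D2) C.
Proof.
elim: As => [|A As IH] //= /andP[fA fAs] dB.
by apply: (o_over_l (G := [:: A])); [apply: o_ax | apply: IH].
Qed.

Lemma over_overs_r As G B :
  derivable_over (G ++ As) B -> derivable_over G (overs B As).
Proof.
elim: As G => [|A As IH] G /=; first by rewrite cats0.
by rewrite -cat_rcons => /IH dB; apply: o_over_r.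
Qed.

Lemma over_bangs_left As D1 G D2 C :
  derivable_over (D1 ++ G ++ map Bang As ++ D2) C ->
  derivable_over (D1 ++ map Bang As ++ G ++ D2) C.
Proof.
elim: As D1 => [|A As IH] D1 //= d.
by rewrite -cat_rcons; apply: IH; rewrite cat_rcons; apply: o_perm2.
Qed.

Lemma over_bangs_right As D1 G D2 C :
  derivable_over (D1 ++ map Bang As ++ G ++ D2) C ->
  derivable_over (D1 ++ G ++ map Bang As ++ D2) C.
Proof.
elim: As D1 => [|A As IH] D1 //= d.
by apply: o_perm1; rewrite -cat_rcons; apply: IH; rewrite cat_rcons.
Qed.

(** Contraction read upwards makes a fresh copy of a banged formula without
    spending the one in the context. *)
Lemma over_bang_absorb D As1 A As2 C :
  derivable_over (D ++ Bang A :: map Bang (As1 ++ A :: As2)) C ->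
  derivable_over (D ++ map Bang (As1 ++ A :: As2)) C.
Proof.
rewrite map_cat /= => d; rewrite catA; apply: o_contr; rewrite -catA.
exact: o_perm1.
Qed.

(** * Queue systems as sequents *)

Section QueueSystem.

Variables (T : countType) (halt : T) (rules : seq (seq T * T * seq T)).

(** Read from the conclusion to the premise, [accepts_rule] is one rewriting
    step u G q |-> G v. *)
Inductive accepts : seq T -> Prop :=
| accepts_halt : accepts [:: halt]
| accepts_rule u q v G :
    (u, q, v) \in rules -> accepts (G ++ v) -> accepts (u ++ rcons G q).

Definition goal : formula := Var 0.

(** The index 0 is reserved for [goal], which must differ from every letter. *)
Definition letter (x : T) : formula := Var (pickle x).+1.

Definition rule_formula (r : seq T * T * seq T) : formula :=
  let: (u, q, v) := r in
  overs (Over (Over goal (letter q)) (overs goal (map letter v)))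
        (map letter u).

(** The banged rules are arguments of this formula because without weakening
    they could not be discarded once the halting letter is reached. *)
Definition halt_formula : formula :=
  overs goal (letter halt :: map Bang (map rule_formula rules)).

Definition rule_context : seq formula :=
  map Bang (halt_formula :: map rule_formula rules).

Lemma letters_in_fragment w : all over_formula (map letter w).
Proof. by elim: w. Qed.

Lemma rules_in_fragment rs : all over_formula (map rule_formula rs).
Proof.
elim: rs => [|[[u q] v] rs IH] //=.
by rewrite !overs_in_fragment /= overs_in_fragment !letters_in_fragment.
Qed.

Lemma rule_context_in_fragment : all over_formula rule_context.
Proof.
by rewrite /rule_context all_map /= overs_in_fragment /= all_map
  !rules_in_fragment.
Qed.

(** The context of banged formulas stands to the right of the word; being
    permutable, it is moved into the part that the subderivation proves. *)
Lemma accepts_derivable w :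
  accepts w -> derivable_over (map letter w ++ rule_context) goal.
Proof.
elim=> {w} [|u q v G r_in _ IH].
  have d : derivable_over
      (halt_formula :: letter halt :: map Bang (map rule_formula rules)) goal.
    rewrite -[X in derivable_over (_ :: X)]cats0.
    apply: (over_overs_l (D1 := [::])); last exact: o_ax.
    by rewrite /= all_map rules_in_fragment.
  exact: (o_perm1 (D1 := [::]) (G := [:: _]) (o_bang_l (G1 := [::]) d)).
rewrite /rule_context.
have [As1 [As2 ctxE]] : exists As1 As2, halt_formula :: map rule_formula rules
    = As1 ++ rule_formula (u, q, v) :: As2.
  case/splitPr: r_in => rs1 rs2; rewrite map_cat /=.
  by exists (halt_formula :: map rule_formula rs1), (map rule_formula rs2).
rewrite ctxE; apply: over_bang_absorb; rewrite -ctxE -/rule_context.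
apply: (o_perm1 (D1 := [::])); apply: (o_bang_l (G1 := [::])) => /=.
rewrite map_cat map_rcons -cats1 -!catA.
apply: (over_overs_l (D1 := [::])); first exact: letters_in_fragment.
have d : derivable_over (Over (Over goal (letter q)) (overs goal (map letter v))
    :: (map letter G ++ rule_context) ++ [:: letter q]) goal.
  apply: (o_over_l (D1 := [::])); last first.
    by apply: (over_overs_l (D1 := [::]) (As := [:: _])) => //; apply: o_ax.
  apply: over_overs_r; rewrite -catA -[map letter v]cats0.
  by apply: over_bangs_left; rewrite cats0 catA -map_cat.
rewrite -[rule_context]cats0.
apply: (over_bangs_right (D1 := [:: _ & map letter G]) (G := [:: _])).
by move: d; rewrite -catA.
Qed.

(** The semantics: formulas as languages.  Since the value of [Bang A] contains
    at most the empty word, banged formulas commute with everything and can be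
    duplicated. *)
Fixpoint lang (A : formula) : seq T -> Prop :=
  match A with
  | Var 0 => accepts
  | Var n.+1 => fun w => exists2 x, pickle x = n & w = [:: x]
  | Over B A => fun w => forall w', lang A w' -> lang B (w ++ w')
  | Under A B => fun w => forall w', lang A w' -> lang B (w' ++ w)
  | Bang A => fun w => w = [::] /\ lang A w
  end.

Fixpoint lang_seq (G : seq formula) : seq T -> Prop :=
  if G is A :: G' then
    fun w => exists w1 w2, [/\ w = w1 ++ w2, lang A w1 & lang_seq G' w2]
  else fun w => w = [::].

Lemma lang_seq_cat G1 G2 w :
  lang_seq (G1 ++ G2) w <->
  exists w1 w2, [/\ w = w1 ++ w2, lang_seq G1 w1 & lang_seq G2 w2].
Proof.
elim: G1 w => [|A G1 IH] w /=.
  by split=> [|[w1 [w2 [-> -> //]]]]; exists [::], w.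
split=> [[w1 [_ [-> Aw1 /IH[w2 [w3 [-> ? ?]]]]]]|].
  by exists (w1 ++ w2), w3; rewrite catA; split=> //; exists w1, w2.
case=> _ [w3 [-> [w1 [w2 [-> ? ?]]] ?]].
by exists w1, (w2 ++ w3); rewrite catA; split=> //; apply/IH; exists w2, w3.
Qed.

Lemma lang_seq1 A w : lang_seq [:: A] w <-> lang A w.
Proof.
split=> [[w1 [_ [-> Aw ->]]]|Aw]; first by rewrite cats0.
by exists w, [::]; rewrite cats0.
Qed.

Lemma lang_seq_bangs G w : lang_seq (map Bang G) w -> w = [::].
Proof. by elim: G w => [|A G IH] //= w [w1 [w2 [-> [-> _] /IH->]]]. Qed.

Lemma lang_seq_mono G G' D1 D2 w :
  (forall w, lang_seq G w -> lang_seq G' w) ->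
  lang_seq (D1 ++ G ++ D2) w -> lang_seq (D1 ++ G' ++ D2) w.
Proof.
move=> sub /lang_seq_cat[w1 [_ [-> h1 /lang_seq_cat[w2 [w3 [-> h2 h3]]]]]].
apply/lang_seq_cat; exists w1, (w2 ++ w3); split=> //.
by apply/lang_seq_cat; exists w2, w3; split=> //; apply: sub.
Qed.

Lemma lang_seq_bang_comm A G w :
  lang_seq (Bang A :: G) w <-> lang_seq (G ++ [:: Bang A]) w.
Proof.
split=> [[w1 [w2 [-> [-> Aw] Gw]]]|].
  apply/lang_seq_cat; exists w2, [::]; split=> //; first by rewrite cats0.
  exact/lang_seq1.
case/lang_seq_cat=> w1 [w2 [-> Gw /lang_seq1[-> Aw]]].
by exists [::], w1; rewrite cats0.
Qed.

Lemma lang_sound G C : derivable G C -> forall w, lang_seq G w -> lang C w.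
Proof.
elim=> {G C}.
- by move=> A w /lang_seq1.
- move=> G D1 D2 A B C _ IHA _ IHC w Gw; apply: IHC; move: w Gw => w.
  apply: (@lang_seq_mono (_ :: G) [:: B]) => {}w /= [w1 [w2 [-> wBA wA]]].
  by apply/lang_seq1/wBA/IHA.
- move=> G A B _ IH w Gw w' Aw'; apply: IH; rewrite -cats1.
  by apply/lang_seq_cat; exists w, w'; split=> //; apply/lang_seq1.
- move=> G D1 D2 A B C _ IHA _ IHC w; rewrite -cat_rcons -cats1 => Gw.
  apply: IHC; move: w Gw => w.
  apply: (@lang_seq_mono _ [:: B]) => {}w /lang_seq_cat[w1 [w2 [-> wA wAB]]].
  by apply/lang_seq1/(proj1 (lang_seq1 _ _) wAB)/IHA.
- by move=> G A B _ IH w Gw w' Aw'; apply: IH; exists w', w.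
- move=> G1 G2 A C _ IH w Gw; apply: IH; move: w Gw => w.
  apply: (@lang_seq_mono [:: Bang A] [:: A]) => {}w /lang_seq1[_ ?].
  exact/lang_seq1.
- by move=> G B _ IH w Gw; split; [apply: lang_seq_bangs Gw | apply: IH].
- move=> D1 G D2 A C _ IH w Gw; apply: IH; move: w Gw => w.
  rewrite -[G ++ _ :: D2]cat_rcons -cats1.
  by apply: (@lang_seq_mono _ (_ :: G)) => {}w /lang_seq_bang_comm.
- move=> D1 G D2 A C _ IH w Gw; apply: IH; move: w Gw => w.
  rewrite -[G ++ _ :: D2]cat_rcons -cats1.
  by apply: (@lang_seq_mono (_ :: G)) => {}w /lang_seq_bang_comm.
- move=> D1 D2 A C _ IH w Gw; apply: IH; move: w Gw => w.
  apply: (@lang_seq_mono [:: _] [:: _; _]) => {}w /lang_seq1[-> Aw].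
  by exists [::], [::]; split=> //; apply/lang_seq1.
Qed.

Lemma lang_letter x w : lang (letter x) w <-> w = [:: x].
Proof.
split=> [[y /(pcan_inj pickleK)-> ->] //|->]; by exists x.
Qed.

Lemma lang_letters u w : lang_seq (map letter u) w <-> w = u.
Proof.
elim: u w => [|x u IH] w //.
split=> [[w1 [w2 [-> /lang_letter-> /IH->]]] //|->].
by exists [:: x], u; split=> //; [apply/lang_letter | apply/IH].
Qed.

Lemma lang_overs B As w :
  lang (overs B As) w <-> forall w', lang_seq As w' -> lang B (w ++ w').
Proof.
elim: As w => [|A As IH] w /=.
  by split=> [Bw _ ->|/(_ [::])]; rewrite cats0 //; apply.
split=> [h _ [w1 [w2 [-> Aw1 Asw2]]]|h w1 Aw1].
  by rewrite catA; apply: (proj1 (IH _)) => //; apply: h.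
by apply/IH => w2 Asw2; rewrite -catA; apply: h; exists w1, w2.
Qed.

(** The formula of a rule contains the empty word precisely because acceptance
    is closed under that rule. *)
Lemma lang_rule_context : lang_seq rule_context [::].
Proof.
have langB : lang_seq (map Bang (map rule_formula rules)) [::].
  have: {subset rules <= rules} by [].
  elim: {1 3}rules => [|[[u q] v] rs IH] //= sub; exists [::], [::]; split=> //.
    split=> //; apply/lang_overs => _ /lang_letters-> w vw _ /lang_letter->.
    rewrite cats1 -cats1 -catA cats1; apply: (@accepts_rule _ _ v).
      by apply: sub; rewrite mem_head.
    by move/lang_overs: vw; apply; apply/lang_letters.
  by apply: IH => r r_in; apply: sub; rewrite inE r_in orbT.
exists [::], [::]; split=> //; split=> //.
apply/lang_overs => _ [_ [w [-> /lang_letter-> /lang_seq_bangs->]]].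
exact: accepts_halt.
Qed.

Lemma derivable_accepts w :
  derivable (map letter w ++ rule_context) goal -> accepts w.
Proof.
move=> /lang_sound; apply; apply/lang_seq_cat; exists w, [::].
by rewrite cats0; split=> //; [apply/lang_letters | apply: lang_rule_context].
Qed.

End QueueSystem.
Arguments letter {T} x.

(** * Halting of register machines *)

(** Register contents are compared pointwise, which avoids functional
    extensionality. *)
Definition same_config (c d : config) : Prop := pc c = pc d /\ reg c =1 reg d.

Lemma set_reg_ext R R' r v : R =1 R' -> set_reg R r v =1 set_reg R' r v.
Proof. by move=> eR s; rewrite /set_reg eR. Qed.

Lemma step_ext P c d : same_config c d -> same_config (step P c) (step P d).
Proof.
case: c d => [i R] [_ R'] [/= <- eR]; case: (onth P i) => [[r|r j]|] //=.
  by split=> //=; rewrite eR; apply: set_reg_ext.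
by rewrite eR; case: (R' r) => [|m]; split=> //=; apply: set_reg_ext.
Qed.

Lemma iter_step_ext P k c d :
  same_config c d -> same_config (iter k (step P) c) (iter k (step P) d).
Proof. by move=> ecd; elim: k => //= k; apply: step_ext. Qed.

Definition halts (P : program) (c : config) : Prop :=
  exists k, halted P (iter k (step P) c).

Lemma step_halted P c : halted P c -> step P c = c.
Proof. by case: c => i R /onth_default /= ->. Qed.

Lemma halts_step P c : halts P (step P c) <-> halts P c.
Proof.
split=> [[k hk]|[k hk]]; first by exists k.+1; rewrite iterSr.
by exists k; rewrite -iterSr iterS step_halted.
Qed.

Lemma halts_ext P c d : same_config c d -> halts P c -> halts P d.
Proof.
move=> ecd [k hk]; exists k.
by have [epc _] := iter_step_ext P k ecd; rewrite /halted -epc.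
Qed.

Lemma halts_pc P i R : size P <= i -> halts P (Config i R).
Proof. by move=> le_i; exists 0. Qed.

(** * Register machines as queue systems *)

(** [Run i] means that instruction i is to be executed.  A decrement of r
    appends [Mark] and switches to [Seek i], which rotates the queue in search
    of a token r; if one is found, [Back i] goes on rotating without removing
    tokens.  The return of [Mark] to the front ends either phase. *)
Inductive symbol := Token of nat | Mark | Run of nat | Seek of nat | Back of nat.

Definition symbol_code (x : symbol) : nat * nat :=
  match x with
  | Token r => (0, r) | Mark => (1, 0) | Run i => (2, i)
  | Seek i => (3, i) | Back i => (4, i)
  end.

Definition symbol_decode (c : nat * nat) : symbol :=
  match c with
  | (0, r) => Token r | (1, _) => Mark | (2, i) => Run i
  | (3, i) => Seek i | (_, i) => Back i
  end.

Lemma symbol_codeK : cancel symbol_code symbol_decode.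
Proof. by case. Qed.

HB.instance Definition _ := Countable.copy symbol (can_type symbol_codeK).

Lemma token_eqE r s : (Token r == Token s) = (s == r).
Proof. by rewrite eq_sym. Qed.

Definition instr_reg (a : instr) : nat :=
  match a with Inc r => r | Dec r _ => r end.

(** The bound is at least 2 because the input is held in register 1. *)
Definition reg_bound (P : program) : nat :=
  (foldr maxn 1 (map instr_reg P)).+1.

Lemma onth_reg_bound P i a : onth P i = Some a -> instr_reg a < reg_bound P.
Proof.
rewrite /reg_bound ltnS; elim: P i => [|b P IH] [|i] //=.
  by case=> ->; rewrite leq_maxl.
by move/IH => le_a; rewrite leq_max le_a orbT.
Qed.

Lemma reg_bound_gt1 P : 1 < reg_bound P.
Proof.
by rewrite /reg_bound ltnS; elim: P => //= a P IH; rewrite leq_max IH orbT.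
Qed.

Lemma cats2 (T : Type) (G : seq T) x y : G ++ [:: x; y] = rcons (rcons G x) y.
Proof. by rewrite -!cats1 -catA. Qed.

Section Machine.

Variable P : program.

(** A jump target beyond the end of the program is replaced by the size of the
    program, so that a single letter, [Run (size P)], stands for halting. *)
Definition instr_rules (i : nat) (a : instr) :
    seq (seq symbol * symbol * seq symbol) :=
  match a with
  | Inc r => [:: ([::], Run i, [:: Token r; Run i.+1])]
  | Dec r j =>
      [:: ([::], Run i, [:: Mark; Seek i]);
          ([:: Token r], Seek i, [:: Back i]);
          ([:: Mark], Seek i, [:: Run (minn j (size P))]);
          ([:: Mark], Back i, [:: Run i.+1])] ++
      [seq ([:: Token t], Seek i, [:: Token t; Seek i])
         | t <- iota 0 (reg_bound P) & t != r] ++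
      [seq ([:: Token t], Back i, [:: Token t; Back i])
         | t <- iota 0 (reg_bound P)]
  end.

(** The first group of rules erases the tokens left over after halting. *)
Definition machine_rules : seq (seq symbol * symbol * seq symbol) :=
  [seq ([:: Token t], Run (size P), [:: Run (size P)])
     | t <- iota 0 (reg_bound P)] ++
  flatten [seq if onth P i is Some a then instr_rules i a else [::]
             | i <- iota 0 (size P)].

Definition tokens (G : seq symbol) : nat -> nat :=
  fun r => count_mem (Token r) G.

(** The invariant of accepted words: what a word in control state q tells about
    the machine.  It has to pass from G v to u G q for every rule (u, q, v), and
    for this it may depend, during a search, only on whether the tokens A not
    yet inspected (those in front of the mark) include a token r. *)
Definition outcome (G : seq symbol) (q : symbol) : Prop :=
  match q with
  | Run i => Mark \notin G -> halts P (Config i (tokens G))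
  | Seek i => forall r j A B, onth P i = Some (Dec r j) ->
      G = A ++ Mark :: B -> Mark \notin A -> Mark \notin B ->
      halts P (if Token r \in A
               then Config i.+1
                      (set_reg (tokens (A ++ B)) r (tokens (A ++ B) r).-1)
               else Config j (tokens (A ++ B)))
  | Back i => forall A B,
      G = A ++ Mark :: B -> Mark \notin A -> Mark \notin B ->
      halts P (Config i.+1 (tokens (A ++ B)))
  | _ => True
  end.

Lemma tokens_rcons A B x : tokens (A ++ rcons B x) =1 tokens (x :: A ++ B).
Proof.
move=> r; rewrite /tokens /= !count_cat -cats1 count_cat /= addn0.
by rewrite addnA addnC.
Qed.

Lemma halts_clip j R :
  halts P (Config (minn j (size P)) R) -> halts P (Config j R).
Proof. by case: (leqP j (size P)) => // /ltnW lt_j _; apply: halts_pc. Qed.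

(** During a rotation the letter at the front is either the mark, and the
    rotation is complete, or the first of the tokens not yet inspected. *)
Lemma head_before_mark x G A B :
  x :: G = A ++ Mark :: B -> Mark \notin A ->
  (A = [::] /\ x = Mark /\ G = B) \/
  exists A', [/\ A = x :: A', x != Mark, Mark \notin A' & G = A' ++ Mark :: B].
Proof.
case: A => [[-> ->]|_ A' [<- ->]]; first by left.
by rewrite inE negb_or eq_sym => /andP[? ?]; right; exists A'.
Qed.

Lemma outcome_inc i r G : onth P i = Some (Inc r) ->
  outcome (rcons G (Token r)) (Run i.+1) -> outcome G (Run i).
Proof.
move=> Pi /= h mG; apply/halts_step; rewrite /= Pi.
apply: halts_ext (h _); last by rewrite mem_rcons inE.
split=> //= s; rewrite /tokens /set_reg -cats1 count_cat /= addn0.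
rewrite token_eqE.
by case: eqP => [->|]; rewrite ?addn1 ?addn0.
Qed.

Lemma outcome_dec i r j G : onth P i = Some (Dec r j) ->
  outcome (rcons G Mark) (Seek i) -> outcome G (Run i).
Proof.
move=> Pi /= h mG; apply/halts_step; rewrite /= Pi.
have := h _ _ G [::] Pi; rewrite cats1 cats0 => /(_ erefl mG isT).
rewrite -has_pred1 has_count -/(tokens G r).
by case: (tokens G r).
Qed.

Lemma outcome_found i r j G : onth P i = Some (Dec r j) ->
  outcome G (Back i) -> outcome (Token r :: G) (Seek i).
Proof.
move=> Pi /= h r' j' A B; rewrite Pi => -[<- _] e mA mB.
case: (head_before_mark e mA) => [[_ []] //|[A' [-> _ mA' eG]]].
rewrite mem_head; apply: halts_ext (h _ _ eG mA' mB); split=> //= s.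
rewrite /set_reg /tokens /= eqxx.
by rewrite token_eqE; case: eqP => [->|].
Qed.

Lemma outcome_zero i r j G : onth P i = Some (Dec r j) ->
  outcome G (Run (minn j (size P))) -> outcome (Mark :: G) (Seek i).
Proof.
move=> Pi /= h r' j' A B; rewrite Pi => -[_ <-] e mA mB.
case: (head_before_mark e mA) => [[-> [_ eG]]|[A' []] //].
by apply: halts_clip; rewrite -eG in mB *; apply: h.
Qed.

Lemma outcome_back_end i G :
  outcome G (Run i.+1) -> outcome (Mark :: G) (Back i).
Proof.
move=> /= h A B e mA mB.
case: (head_before_mark e mA) => [[-> [_ eG]]|[A' []] //].
by rewrite -eG in mB *; apply: h.
Qed.

Lemma outcome_seek i r j t G : onth P i = Some (Dec r j) -> t != r ->
  outcome (rcons G (Token t)) (Seek i) -> outcome (Token t :: G) (Seek i).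
Proof.
move=> Pi ne_tr /= h r' j' A B; rewrite Pi => -[<- <-] e mA mB.
case: (head_before_mark e mA) => [[_ []] //|[A' [-> _ mA' eG]]].
have := h _ _ A' (rcons B (Token t)) Pi.
rewrite eG rcons_cat /= mem_rcons inE => /(_ erefl mA' mB).
have eq_tokens := tokens_rcons A' B (Token t).
have -> : (Token r \in Token t :: A') = (Token r \in A').
  by rewrite inE token_eqE (negbTE ne_tr).
apply: halts_ext; case: ifP => _; split=> //=.
by rewrite eq_tokens; apply: set_reg_ext.
Qed.

Lemma outcome_back i t G :
  outcome (rcons G (Token t)) (Back i) -> outcome (Token t :: G) (Back i).
Proof.
move=> /= h A B e mA mB.
case: (head_before_mark e mA) => [[_ []] //|[A' [-> _ mA' eG]]].
have := h A' (rcons B (Token t)).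
rewrite eG rcons_cat /= mem_rcons inE => /(_ erefl mA' mB).
by apply: halts_ext; split=> //=; apply: tokens_rcons.
Qed.

Lemma accepts_outcome w : accepts (Run (size P)) machine_rules w ->
  forall G q, w = rcons G q -> outcome G q.
Proof.
elim=> {w} [[|? []] q' //|u q v G].
  by move=> [<-] _; apply: halts_pc.
rewrite -rcons_cat => r_in _ IH ? ? /rcons_inj[<- <-].
have {}IH v' q' : v = rcons v' q' -> outcome (G ++ v') q'.
  by move=> ev; apply: IH; rewrite ev rcons_cat.
move: r_in; rewrite mem_cat => /orP[/mapP[t _ [-> -> _]]|].
  by move=> _; apply: halts_pc.
case/flatten_mapP=> i _; case Pi: (onth P i) => [[r|r j]|] //.
  rewrite inE => /eqP[-> -> ev].
  by move: (IH [:: Token r] (Run i.+1) ev); rewrite cats1; apply: outcome_inc.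
rewrite /instr_rules mem_cat => /orP[|].
  rewrite !inE => /or4P[] /eqP[-> -> ev].
  - move: (IH [:: Mark] (Seek i) ev); rewrite cats1; exact: outcome_dec Pi.
  - by move: (IH [::] (Back i) ev); rewrite cats0; apply: outcome_found Pi.
  - by move: (IH [::] (Run _) ev); rewrite cats0; apply: outcome_zero Pi.
  - by move: (IH [::] (Run _) ev); rewrite cats0; apply: outcome_back_end.
rewrite mem_cat => /orP[] /mapP[t]; last first.
  move=> _ [-> -> ev]; move: (IH [:: Token t] (Back _) ev).
  by rewrite cats1; apply: outcome_back.
rewrite mem_filter => /andP[ne_tr _] [-> -> ev].
move: (IH [:: Token t] (Seek _) ev); rewrite cats1.
exact: outcome_seek Pi ne_tr.
Qed.

Lemma accepts_halts G i : Mark \notin G ->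
  accepts (Run (size P)) machine_rules (rcons G (Run i)) ->
  halts P (Config i (tokens G)).
Proof. by move=> mG /accepts_outcome/(_ _ _ erefl); apply. Qed.

Definition register_token (x : symbol) : bool :=
  if x is Token r then r < reg_bound P else false.

Local Notation acc := (accepts (Run (size P)) machine_rules).

Lemma accepts_instr i a u q v G : onth P i = Some a ->
  (u, q, v) \in instr_rules i a -> acc (G ++ v) -> acc (u ++ rcons G q).
Proof.
move=> Pi r_in; apply: accepts_rule; rewrite mem_cat; apply/orP; right.
apply/flatten_mapP; exists i; last by rewrite Pi.
rewrite mem_iota /= add0n ltnNge; apply/negP => /onth_default.
by rewrite Pi.
Qed.

Lemma accepts_erase G : all register_token G -> acc (rcons G (Run (size P))).
Proof.
elim: G => [|[r||||] G IH] //= => [_|/andP[lt_r allG]].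
  exact: accepts_halt.
apply: (@accepts_rule _ _ _ [:: Token r] _ [:: Run (size P)]).
  by rewrite mem_cat map_f // mem_iota.
by rewrite cats1; apply: IH.
Qed.

Lemma accepts_back i r j A B : onth P i = Some (Dec r j) ->
  all register_token A -> acc (rcons (B ++ A) (Run i.+1)) ->
  acc (rcons (A ++ Mark :: B) (Back i)).
Proof.
move=> Pi; elim: A B => [|[t||||] A IH] B //=.
  move=> _; rewrite cats0 => accB.
  apply: (accepts_instr (u := [:: Mark]) (v := [:: Run i.+1]) Pi).
    by rewrite !inE eqxx !orbT.
  by rewrite cats1.
case/andP=> lt_t allA accBA.
apply: (accepts_instr (u := [:: Token t]) (v := [:: Token t; Back i]) Pi).
  rewrite /instr_rules 2!mem_cat; apply/orP; right; apply/orP; right.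
  by apply: map_f; rewrite mem_iota.
rewrite cats2 rcons_cat /=; apply: IH => //.
by rewrite cat_rcons.
Qed.

(** The premise asks for acceptance from every arrangement of the tokens, since
    the rotation changes their order. *)
Lemma accepts_seek i r j A B : onth P i = Some (Dec r j) ->
  all register_token A -> all register_token B ->
  (forall G, all register_token G -> 
     if Token r \in A
     then tokens G =1 set_reg (tokens (A ++ B)) r (tokens (A ++ B) r).-1 ->
          acc (rcons G (Run i.+1))
     else tokens G =1 tokens (A ++ B) ->
          acc (rcons G (Run (minn j (size P))))) ->
  acc (rcons (A ++ Mark :: B) (Seek i)).
Proof.
move=> Pi; elim: A B => [|[t||||] A IH] B //=.
  move=> _ allB /(_ _ allB)/(_ (fun=> erefl)) accB.
  apply: (accepts_instr (u := [:: Mark]) (v := [:: Run (minn j (size P))]) Pi).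
    by rewrite !inE eqxx !orbT.
  by rewrite cats1.
case/andP=> lt_t allA allB accG.
have [et|ne_tr] := eqVneq t r.
  subst t.
  apply: (accepts_instr (u := [:: Token r]) (v := [:: Back i]) Pi).
    by rewrite !inE eqxx !orbT.
  rewrite cats1; apply: (accepts_back Pi allA).
  have := accG (B ++ A); rewrite all_cat allA allB mem_head; apply=> // s.
  rewrite /set_reg /tokens /= eqxx.
  by rewrite token_eqE !count_cat addnC; case: eqP => [->|].
apply: (accepts_instr (u := [:: Token t]) (v := [:: Token t; Seek i]) Pi).
  rewrite /instr_rules 2!mem_cat; apply/orP; right; apply/orP; left.
  by apply: map_f; rewrite mem_filter ne_tr mem_iota.
rewrite cats2 rcons_cat /=; apply: IH => //.
  by rewrite all_rcons /= lt_t.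
move=> G /accG; have eT := tokens_rcons A B (Token t).
rewrite inE token_eqE (negbTE ne_tr) /=.
case: ifP => _ acc_if eG; apply: acc_if => s.
  by rewrite eG eT; apply: set_reg_ext.
by rewrite eG eT.
Qed.

Lemma halts_accepts G i : all register_token G ->
  halts P (Config i (tokens G)) -> acc (rcons G (Run (minn i (size P)))).
Proof.
move=> allG [k]; move eR: (tokens G) => R.
have {eR} eR : tokens G =1 R by rewrite eR.
elim: k i G R allG eR => [|k IH] i G R allG eR.
  by rewrite /halted /= => /minn_idPr->; apply: accepts_erase.
have [le_i _|lt_i] := leqP (size P) i.
  exact: accepts_erase.
rewrite iterSr; case Pi: (onth P i) => [a|]; last first.
  by move: (onthTE P i); rewrite Pi lt_i.
have next : i.+1 = minn i.+1 (size P) by rewrite (minn_idPl _).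
have lt_a := onth_reg_bound Pi.
case: a Pi lt_a => [r|r j] Pi /= lt_r; rewrite Pi.
  move=> hk.
  apply: (accepts_instr (u := [::]) (v := [:: Token r; Run i.+1]) Pi).
    by rewrite inE.
  rewrite cats2 next; apply: IH hk; first by rewrite all_rcons /= lt_r.
  move=> s; rewrite /tokens -cats1 count_cat /= addn0 /set_reg -eR.
  rewrite token_eqE.
  by case: eqP => [->|_]; rewrite ?addn1 ?addn0 //; apply: eR.
move=> hk; apply: (accepts_instr (u := [::]) (v := [:: Mark; Seek i]) Pi).
  by rewrite inE eqxx.
rewrite cats2 -[rcons G _]cats1; apply: (accepts_seek Pi) => // G' allG'.
rewrite cats0 -has_pred1 has_count -/(tokens G r).
move: hk; rewrite -eR; case eGr: (tokens G r) => [|m] hk /= eG'.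
  by apply: IH hk => // s; rewrite eG'.
by rewrite next; apply: IH hk => // s; rewrite eG'; apply: set_reg_ext.
Qed.

End Machine.

(** * Program fragments *)

Lemma same_config_sym c d : same_config c d -> same_config d c.
Proof. by case=> p r; split=> [|s]; rewrite ?p ?r. Qed.

Definition reaches (P : program) (c d : config) : Prop :=
  exists k, same_config (iter k (step P) c) d.

Lemma reaches_refl P i R R' :
  R =1 R' -> reaches P (Config i R) (Config i R').
Proof. by move=> eR; exists 0. Qed.

Lemma reaches_step P c d : same_config (step P c) d -> reaches P c d.
Proof. by exists 1. Qed.

Lemma reaches_trans P c d f : reaches P c d -> reaches P d f -> reaches P c f.
Proof.
move=> [k ecd] [l [pdf rdf]]; exists (l + k); rewrite iterD.
have [p r] := iter_step_ext P l ecd.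
by split=> [|s]; [rewrite p | rewrite r].
Qed.

Lemma halts_reaches P c d : reaches P c d -> halts P c <-> halts P d.
Proof.
case=> k ecd; have iter_halts l : halts P (iter l (step P) c) <-> halts P c.
  by elim: l => //= l IH; split=> [/halts_step/IH|/IH/halts_step].
split=> [/(iter_halts k)|] h; last apply/(iter_halts k).
  exact: halts_ext ecd h.
by apply: halts_ext h; apply: same_config_sym.
Qed.

Lemma onth_size_cat (T : Type) (s1 s2 : seq T) x :
  onth (s1 ++ x :: s2) (size s1) = Some x.
Proof. by rewrite onth_cat ltnn subnn. Qed.

(** Jumps are absolute, so a fragment is a function of its own address. *)
Definition code_block : Type := nat -> program.

(** Registers are given by a list, with 0 beyond its end. *)
Definition computes_block (F : code_block) (s s' : seq nat) : Prop :=
  forall A D, reaches (A ++ F (size A) ++ D) (Config (size A) (nth 0 s))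
                      (Config (size A + size (F (size A))) (nth 0 s')).

Definition add_block (r k : nat) : code_block := fun=> nseq k (Inc r).

Definition seq_block (F G : code_block) : code_block :=
  fun i => F i ++ G (i + size (F i)).

(** While register r is nonzero, decrement it and run F.  Register z always
    contains 0, which makes [Dec z i] an unconditional jump. *)
Definition loop_block (z r : nat) (F : code_block) : code_block :=
  fun i => Dec r (i + (size (F i.+1)).+2) :: rcons (F i.+1) (Dec z i).

Lemma set_nth_reg s r v :
  nth 0 (set_nth 0 s r v) =1 set_reg (nth 0 s) r v.
Proof. by move=> i; rewrite nth_set_nth /set_reg /=; case: eqP. Qed.

Lemma computes_add r k s :
  computes_block (add_block r k) s (set_nth 0 s r (nth 0 s r + k)).
Proof.
elim: k s => [|k IH] s A D /=.
  rewrite !addn0; apply: reaches_refl => i; rewrite set_nth_reg /set_reg.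
  by case: eqP => [->|].
apply: (@reaches_trans _ _
  (Config (size A).+1 (nth 0 (set_nth 0 s r (nth 0 s r).+1)))).
  apply: reaches_step; rewrite /= onth_size_cat; split=> //= i.
  by rewrite set_nth_reg.
have := IH (set_nth 0 s r (nth 0 s r).+1) (rcons A (Inc r)) D.
rewrite cat_rcons size_rcons /add_block /= addSnnS => h.
apply: reaches_trans h _; apply: reaches_refl => i.
rewrite !set_nth_reg /set_reg !nth_set_nth /= eqxx.
by case: eqP => // _; rewrite addSnnS.
Qed.

Lemma computes_seq F G s1 s2 s3 : computes_block F s1 s2 ->
  computes_block G s2 s3 -> computes_block (seq_block F G) s1 s3.
Proof.
move=> hF hG A D; rewrite /seq_block size_cat addnA -catA.
apply: reaches_trans (hF A _) _.
by have := hG (A ++ F (size A)) D; rewrite size_cat -catA.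
Qed.

Lemma computes_loop z r F (st : nat -> seq nat) n :
  (forall m, m <= n -> nth 0 (st m) r = m) ->
  (forall m, m <= n -> nth 0 (st m) z = 0) ->
  (forall m, m < n -> computes_block F (set_nth 0 (st m.+1) r m) (st m)) ->
  computes_block (loop_block z r F) (st n) (st 0).
Proof.
move=> str stz hF A D; rewrite /loop_block /= size_rcons.
elim: n str stz hF => [|n IH] str stz hF.
  by apply: reaches_step; rewrite /= onth_size_cat str.
apply: (@reaches_trans _ _
  (Config (size A).+1 (nth 0 (set_nth 0 (st n.+1) r n)))).
  apply: reaches_step; rewrite /= onth_size_cat str //; split=> //= i.
  by rewrite set_nth_reg.
set body := F _; set d := Dec r _.
apply: reaches_trans.
  have := hF n (leqnn _) (rcons A d) (Dec z (size A) :: D).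
  by rewrite size_rcons cat_rcons -/body -[body ++ _ :: D]cat_rcons; apply.
apply: (@reaches_trans _ _ (Config (size A) (nth 0 (st n)))).
  apply: reaches_step; rewrite /step cat_rcons -cat_cons catA.
  have -> : (size A).+1 + size body = size (A ++ d :: body).
    by rewrite size_cat /= addnS.
  by rewrite onth_size_cat stz.
by apply: IH => m lt_m; [apply: str|apply: stz|apply: hF]; apply: ltnW.
Qed.

(** Maps the content m of register 0 to K * (2 m + 1), one step of
    [CodeSeq.code] when K is a power of 2.  Register 3 is scratch space and
    register 4 remains 0. *)
Definition affine_block (K : nat) : code_block :=
  seq_block (loop_block 4 0 (add_block 3 K.*2))
    (seq_block (add_block 0 K) (loop_block 4 3 (add_block 0 1))).

Lemma computes_affine K m e e' :
  computes_block (affine_block K) [:: m; e; e'; 0] [:: K * m.*2.+1; e; e'; 0].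
Proof.
apply: (computes_seq (s2 := [:: 0; e; e'; K.*2 * m])).
  have := @computes_loop 4 0 (add_block 3 K.*2)
    (fun l => [:: l; e; e'; K.*2 * (m - l)]) m.
  rewrite subnn subn0 muln0; apply=> // l lt_l.
  by have := @computes_add 3 K.*2 [:: l; e; e'; K.*2 * (m - l.+1)];
     rewrite /= -mulnSr subnSK.
apply: (computes_seq (s2 := [:: K; e; e'; K.*2 * m])).
  exact: (@computes_add 0).
have := @computes_loop 4 3 (add_block 0 1)
  (fun l => [:: K + (K.*2 * m - l); e; e'; l]) (K.*2 * m).
rewrite subnn subn0 addn0 -doubleMl doubleMr -mulnS; apply=> // l lt_l.
by have := @computes_add 0 1 [:: K + (K * m.*2 - l.+1); e; e'; l];
   rewrite /= -addnA addn1 subnSK.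
Qed.

(** The input e in register 1 serves twice: copied to register 0 as the
    starting value, and to register 2 as the number of iterations. *)
Definition sequent_code_block (K L : nat) : code_block :=
  seq_block (loop_block 4 1 (seq_block (add_block 0 1) (add_block 2 1)))
    (seq_block (loop_block 4 2 (affine_block K)) (affine_block L)).

Arguments sequent_code_block : simpl never.

Lemma computes_sequent_code K L e :
  computes_block (sequent_code_block K L) [:: 0; e]
    [:: L * (iter e (fun m => K * m.*2.+1) e).*2.+1; 0; 0; 0].
Proof.
set f := fun m => K * m.*2.+1.
have h0 : computes_block (sequent_code_block K L) [:: 0; e; 0; 0]
    [:: L * (iter e f e).*2.+1; 0; 0; 0].
  apply: (computes_seq (s2 := [:: e; 0; e; 0])).
    have := @computes_loop 4 1 (seq_block (add_block 0 1) (add_block 2 1))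
      (fun l => [:: e - l; l; e - l; 0]) e.
    rewrite subnn subn0; apply=> // l lt_l.
    apply: (computes_seq (s2 := [:: e - l; l; e - l.+1; 0])).
      by have := @computes_add 0 1 [:: e - l.+1; l; e - l.+1; 0];
         rewrite /= addn1 subnSK.
    by have := @computes_add 2 1 [:: e - l; l; e - l.+1; 0];
       rewrite /= addn1 subnSK.
  apply: (computes_seq (s2 := [:: iter e f e; 0; 0; 0])); last first.
    exact: computes_affine.
  have := @computes_loop 4 2 (affine_block K)
    (fun l => [:: iter (e - l) f e; 0; l; 0]) e.
  rewrite subnn subn0; apply=> // l lt_l.
  have := @computes_affine K (iter (e - l.+1) f e) 0 l.
  by rewrite -/(f _) -iterS subnSK.
move=> A D; have := h0 A D; apply: reaches_trans; apply: reaches_refl.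
by move=> [|[|[|[|i]]]] /=; rewrite ?nth_nil.
Qed.

(** * The diagonal program *)

Definition relocate_instr (off n : nat) (a : instr) : instr :=
  if a is Dec r j then Dec r (off + minn j n) else a.

Definition relocate (off : nat) (P : program) : program :=
  map (relocate_instr off (size P)) P.

Definition shift_config (off n : nat) (c : config) : config :=
  Config (off + minn (pc c) n) (reg c).

(** Wherever P halts, its relocated copy ends at the first instruction after
    it, thanks to the truncation of program counters and jump targets. *)
Lemma reaches_relocate A P D k c :
  reaches (A ++ relocate (size A) P ++ D) (shift_config (size A) (size P) c)
    (shift_config (size A) (size P) (iter k (step P) c)).
Proof.
elim: k c => [|k IH] c; first exact: reaches_refl.
rewrite iterSr; apply: reaches_trans (IH _).
case: c => i R; have [le_i|lt_i] := leqP (size P) i.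
  by rewrite step_halted //; apply: reaches_refl.
apply: reaches_step.
case Pi: (onth P i) => [a|]; last by move: (onthTE P i); rewrite Pi lt_i.
have min_i : minn i (size P) = i by apply/minn_idPl/ltnW.
have min_i1 : minn i.+1 (size P) = i.+1 by apply/minn_idPl.
rewrite /shift_config /= min_i onth_cat ltnNge leq_addr /= addKn onth_cat.
rewrite size_map lt_i onth_map Pi.
case: a Pi => [r|r j] Pi /=; first by rewrite min_i1 addnS.
by case: (R r) => [|m] //=; rewrite min_i1 addnS.
Qed.

Definition answer_pc (K L : nat) (P : program) : nat :=
  size (sequent_code_block K L 0) + size P.

(** The last two instructions read the answer of P in register 0: on 0 the
    first one jumps past the end, and on 1 it clears the register, after which
    the second one jumps to itself forever. *)
Definition diagonal (K L : nat) (P : program) : program :=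
  sequent_code_block K L 0 ++ relocate (size (sequent_code_block K L 0)) P ++
  [:: Dec 0 (answer_pc K L P).+2; Dec 0 (answer_pc K L P).+1].

Lemma size_diagonal K L P : size (diagonal K L P) = (answer_pc K L P).+2.
Proof. by rewrite /diagonal /answer_pc !size_cat size_map addnA addn2. Qed.

Lemma onth_diagonal K L P i :
  onth (diagonal K L P) (answer_pc K L P + i) =
  onth [:: Dec 0 (answer_pc K L P).+2; Dec 0 (answer_pc K L P).+1] i.
Proof.
rewrite /diagonal onth_cat -addnA ltnNge leq_addr /= addKn onth_cat.
by rewrite size_map ltnNge leq_addr /= addKn.
Qed.

Lemma diagonal_reaches K L P e m :
  computes P (L * (iter e (fun m => K * m.*2.+1) e).*2.+1) m ->
  exists2 R, R 0 = m & reaches (diagonal K L P) (Config 0 (nth 0 [:: 0; e]))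
    (Config (answer_pc K L P) R).
Proof.
move=> [k [halt_k <-]]; set c := iter k _ _ in halt_k *.
exists (reg c) => //.
apply: (reaches_trans (computes_sequent_code K L e [::] _)); rewrite add0n.
set A := sequent_code_block K L 0; set N := _ * _; set D := [:: _; _].
have := reaches_relocate A P D k (initial N).
rewrite -/c /shift_config /= min0n addn0 (minn_idPr halt_k).
by apply: reaches_trans; apply: reaches_refl; move=> [|[|[|[|i]]]];
   rewrite /set_reg /= ?nth_nil.
Qed.

Lemma diagonal_halts K L P e :
  computes P (L * (iter e (fun m => K * m.*2.+1) e).*2.+1) 0 ->
  halts (diagonal K L P) (Config 0 (nth 0 [:: 0; e])).
Proof.
case/diagonal_reaches=> R R0 h; apply/(halts_reaches h)/halts_step.
have := onth_diagonal K L P 0; rewrite addn0 /step => ->; rewrite /= R0.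
by apply: halts_pc; rewrite size_diagonal.
Qed.

Lemma diagonal_diverges K L P e :
  computes P (L * (iter e (fun m => K * m.*2.+1) e).*2.+1) 1 ->
  ~ halts (diagonal K L P) (Config 0 (nth 0 [:: 0; e])).
Proof.
case/diagonal_reaches=> R R0 h /(halts_reaches h)/halts_step.
have := onth_diagonal K L P 0; rewrite addn0 /step => ->; rewrite /= R0.
set d := Config _ _; have loop : step (diagonal K L P) d = d.
  by have := onth_diagonal K L P 1; rewrite addn1 /d /step => ->.
case=> k; suff -> : iter k (step (diagonal K L P)) d = d.
  by rewrite /halted size_diagonal ltnn.
by elim: k => //= k ->.
Qed.

Lemma token_input e :
  tokens (nseq e (Token 1)) =1 nth 0 [:: 0; e].
Proof.
move=> r; rewrite /tokens count_nseq /= token_eqE.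
by case: r => [|[|[|r]]]; rewrite ?mul1n.
Qed.

Lemma accepts_iff_halts P e :
  accepts (Run (size P)) (machine_rules P) (rcons (nseq e (Token 1)) (Run 0)) <->
  halts P (Config 0 (nth 0 [:: 0; e])).
Proof.
have same_input : same_config (Config 0 (tokens (nseq e (Token 1))))
                              (Config 0 (nth 0 [:: 0; e])).
  by split=> // r; apply: token_input.
split=> [/accepts_halts h|h].
  by apply: halts_ext same_input (h _); apply/negP => /nseqP[].
have := @halts_accepts P (nseq e (Token 1)) 0; rewrite min0n; apply.
  by rewrite all_nseq; apply/orP; right; apply: reg_bound_gt1.
exact: halts_ext (same_config_sym same_input) h.
Qed.

Lemma code_nseq_cat l n s :
  CodeSeq.code (nseq l n ++ s) =
  iter l (fun m => 2 ^ n * m.*2.+1) (CodeSeq.code s).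
Proof. by elim: l => //= l ->. Qed.

(** A single sequent of the fragment defeats the program P, for any relation
    between derivability in the fragment and derivability in the full calculus:
    on that sequent the two agree with halting of the diagonal program. *)
Lemma undecidable_between (I : pred sequent)
    (D : seq formula -> formula -> Prop) :
  (forall S, over_sequent S -> I S) ->
  (forall G C, derivable_over G C -> D G C) ->
  (forall G C, D G C -> derivable G C) ->
  ~ decidable_on I D.
Proof.
move=> over_I over_D D_der [P decP].
(* The numbers are kept abstract, together with the equations defining them:
   written out, they are towers of exponentials. *)
have [K eK] := ex_intro (eq^~ _) (2 ^ code_formula (letter (Token 1))) erefl.
have [L eL] := ex_intro (eq^~ _) (2 ^ code_formula goal) erefl.
pose Q := diagonal K L P.
pose B := rule_context (Run (size Q)) (machine_rules Q).
have [e ee] := ex_intro (eq^~ _)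
  (CodeSeq.code (map code_formula (letter (Run 0) :: B))) erefl.
pose Pi := map letter (rcons (nseq e (Token 1)) (Run 0)) ++ B.
have Pi_halts : D Pi goal <-> halts Q (Config 0 (nth 0 [:: 0; e])).
  split=> [/D_der/derivable_accepts/accepts_iff_halts //|].
  by move=> /accepts_iff_halts/accepts_derivable/over_D.
have codePi : code_sequent (Pi, goal) =
    L * (iter e (fun m => K * m.*2.+1) e).*2.+1.
  have -> : Pi = nseq e (letter (Token 1)) ++ letter (Run 0) :: B.
    by rewrite /Pi map_rcons map_nseq cat_rcons.
  have code_cons n s : CodeSeq.code (n :: s) = 2 ^ n * (CodeSeq.code s).*2.+1.
    by [].
  by rewrite /code_sequent code_cons -eL map_cat map_nseq code_nseq_cat -eK -ee.
have over_Pi : over_sequent (Pi, goal).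
  rewrite /over_sequent andbT all_cat letters_in_fragment.
  exact: rule_context_in_fragment.
have [decT decF] := decP _ _ (over_I _ over_Pi).
rewrite codePi in decT decF.
have notPi : ~ D Pi goal.
  by move=> dPi; case: (diagonal_diverges (decT dPi)); apply/Pi_halts.
by apply/notPi/Pi_halts/diagonal_halts/decF.
Qed.

Theorem theorem1 :
  ~ decidable_on predT derivable /\ ~ decidable_on over_sequent derivable_over.
Proof.
split; apply: undecidable_between => //; exact: derivable_over_derivable.
Qed.
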